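(* Extensional presentations of the minimally distributive subgroup form $\operatorname{Sub}\to\mathbf{Grp}$ are naturally in bijection with functorial non-Archimedean group topologies. They are equivalently its strong extensional presentations. More explicitly, both are determined by assignments $G\mapsto\mathcal N(G)$ such that: (i) $\mathcal N(G)$ is a filter in the lattice of subgroups of $G$, where the improper filter is allowed; (ii) for every homomorphism $f:G\to H$ and every $U\in\mathcal N(H)$, one has $f^{-1}(U)\in\mathcal N(G)$. Under the equivalence, $\mathcal N(G)$ is the filter of open subgroups (and is the kernel fibre over $G$ of the extensional presentation). Moreover, $G$ is Hausdorff for the extensional presentation if and only if the corresponding topological group is Hausdorff.
   Context: **Size.** The base category $\mathcal C=\mathbf{Grp}$ (groups and homomorphisms) is treated as small relative to a suitable universe. **Forms.** A form over $\mathcal C$ with finite indexed meets is a faithful amnestic functor $p$ to $\mathcal C$ in which finite structured sources have initial lifts; equivalently a functor $F:\mathcal C^{\mathrm{op}}\to\mathbf{Meet}_\top$, where $\mathbf{Meet}_\top$ is the category of meet-semilattices with top and maps preserving finite meets (including top). Elements of $F_X$ are called clusters over $X$; $f^*:F_Y\to F_X$ is the action of $f:X\to Y$; $\top_X$ is the top of $F_X$. A structured sink over $X$ is a small family $(A_i,f_i)_{i}$ with $f_i:X_i\to X$ and $A_i\in F_{X_i}$. Its final lift, if it exists, is the least $U\in F_X$ with $A_i\le f_i^*U$ for all $i$; one writes $U=\nabla_i(A_i,f_i)$, and the whole datum (sink and $U$) is a final presentation. **Distributivity forms.** A distributivity form is a form $F$ with finite indexed meets together with a class of final presentations, called admissible,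 such that: (D1) every unit presentation $A=\nabla(A,1_X)$ is admissible, and admissibility is invariant under bijective reindexing; (D2) if $U=\nabla_i(A_i,f_i)$ and $A_i=\nabla_j(B_{ij},g_{ij})$ (all $i$) are admissible, so is $U=\nabla_{i,j}(B_{ij},f_ig_{ij})$; (D3) if $U=\nabla_i(A_i,f_i)$ is admissible and $C\in F_X$, then $U\wedge C=\nabla_i(A_i\wedge f_i^*C,f_i)$ is an admissible final presentation. It is strong if moreover: (D4) for every admissible $U=\nabla_i(A_i,f_i)$ over $X$ and $h:Y\to X$, with pullbacks $h_i:Y_i\to X_i$, $f_i':Y_i\to Y$ of $f_i$ and $h$, $h^*U=\nabla_i(h_i^*A_i,f_i')$ is an admissible final presentation. Presentations are regarded up to isomorphism of their sources, i.e. $(A_i,f_i)$ may be replaced by $(\theta_i^*A_i,f_i\theta_i)$ with $\theta_i$ invertible. The minimal distributivity is the one in which only unit presentations $A=\nabla(A,1_X)$ are admissible (up to this convention). **Morphisms.** A morphism $u:F\to G$ of distributivity forms over $\mathcal C$ is a natural transformation with finite-meet-preserving components such that, for each admissible $U=\nabla_i(A_i,f_i)$ in $F$, $u_X(U)=\nabla_i(u_{X_i}(A_i),f_i)$ is an admissible final presentation in $G$. This gives the category $\mathbf{DFrm}(\mathcal C)$ and its full subcategory $\mathbf{SDFrm}(\mathcal C)$ of strong distributivity forms. **Extensional presentations.** A morphism $n:F\to G$ is null if $n_X(A)=\top_X$ for all $X$ and $A\in F_X$. A relative kernel of $u:F\to G$ is a morphism $k:K\to F$ with $uk$ null through which every $h:H\to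 F$ with $uh$ null factors uniquely; relative cokernels are defined dually. A pair $K\xrightarrow{k}F\xrightarrow{q}Q$ is short exact if $k$ is a kernel of $q$ and $q$ is a cokernel of $k$. An extensional presentation of $F$ is an isomorphism class, fixing $F$, of short exact sequences in $\mathbf{DFrm}(\mathcal C)$ with middle term $F$; a strong extensional presentation is the same notion in $\mathbf{SDFrm}(\mathcal C)$. Up to isomorphism the kernel term is identified with the subform $K_X=\{A\in F_X\mid q_X(A)=\top_X\}$. If $F_X$ has a least cluster $\bot_X$, the object $X$ is Hausdorff for the extensional presentation if $\bot_X$ is the greatest lower bound of $K_X$ in $F_X$. **Subgroup form.** $\operatorname{Sub}$ has as clusters over $G$ the subgroups of $G$, ordered by inclusion, with $\top_G=G$, $A\wedge B=A\cap B$, $f^*B=f^{-1}(B)$. **Topologies.** A topological group is non-Archimedean if it has a neighbourhood basis at the identity consisting of open subgroups (Hausdorffness not required). A functorial non-Archimedean group topology is an assignment to each group $G$ of a non-Archimedean group topology $\tau_G$ on $G$ such that every group homomorphism is continuous. *)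

(* Defs.v *)
From HB Require Import structures.
From mathcomp Require Import all_boot all_order.
From mathcomp Require Import all_classical topology.

Set Implicit Arguments.
Unset Strict Implicit.
Unset Printing Implicit Defensive.

Import Order.TTheory.
Local Open Scope classical_set_scope.

Record category := Category {
  obj :> Type;
  hom : obj -> obj -> Type;
  idc : forall X, hom X X;
  compc : forall X Y Z, hom Y Z -> hom X Y -> hom X Z;
  comp_idl : forall X Y (f : hom X Y), compc (idc Y) f = f;
  comp_idr : forall X Y (f : hom X Y), compc f (idc X) = f;
  compA : forall X Y Z W (h : hom Z W) (g : hom Y Z) (f : hom X Y),
    compc h (compc g f) = compc (compc h g) f }.

Arguments idc {c} X.

Declare Scope cat_scope.
Delimit Scope cat_scope with cat.
Local Open Scope cat_scope.
Notation "g \oc f" := (compc g f) (at level 40, left associativity) : cat_scope.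

Definition is_iso (C : category) (X Y : C) (f : hom X Y) :=
  exists g : hom Y X, g \oc f = idc X /\ f \oc g = idc Y.

Definition is_pullback (C : category) (X Y Z P : C) (f : hom X Z) (g : hom Y Z)
    (p : hom P X) (q : hom P Y) :=
  f \oc p = g \oc q /\
  forall (T : C) (a : hom T X) (b : hom T Y), f \oc a = g \oc b ->
    exists! c : hom T P, p \oc c = a /\ q \oc c = b.

(* All fibres share one display; displays only affect printing. *)
Definition form_display : Order.disp_t := Order.Disp tt tt.

(* A faithful amnestic functor to C in which finite structured sources have   *)
(* initial lifts, presented by its fibres and the pullback maps between them. *)
Record form (C : category) := Form {
  fiber :> C -> tMeetSemilatticeType form_display;
  pull : forall X Y, hom X Y -> fiber Y -> fiber X;
  pull_id : forall X (A : fiber X), pull (idc X) A = A;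
  pull_comp : forall X Y Z (g : hom Y Z) (f : hom X Y) (A : fiber Z),
    pull (g \oc f) A = pull f (pull g A);
  pull_top : forall X Y (f : hom X Y), pull f \top%O = \top%O;
  pull_meet : forall X Y (f : hom X Y),
    {morph pull f : A B / (A `&` B)%O} }.

(* The index types of structured sinks range over a universe in which Grp is  *)
(* small: see Grp_small.                                                      *)
Definition small := Type.

Section Sinks.
Variables (C : category) (F : form C).

Record sink (X : C) := Sink {
  sidx : small;
  src : sidx -> C;
  cls : forall i, F (src i);
  arr : forall i, hom (src i) X }.

Arguments src {X} s i.
Arguments cls {X} s i.
Arguments arr {X} s i.

Definition is_final (X : C) (S : sink X) (U : F X) :=
  (forall i, cls S i <= pull (arr S i) U)%O /\
  forall V : F X, (forall i, cls S i <= pull (arr S i) V)%O -> (U <= V)%O.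

Definition unit_sink (X : C) (A : F X) : sink X :=
  @Sink X unit (fun=> X) (fun=> A) (fun=> idc X).

Definition reindex_sink (X : C) (S : sink X) (J : small) (s : J -> sidx S) :=
  @Sink X J (fun j => src S (s j)) (fun j => cls S (s j)) (fun j => arr S (s j)).

Definition change_sources (X : C) (S : sink X) (Y : sidx S -> C)
    (theta : forall i, hom (Y i) (src S i)) : sink X :=
  @Sink X (sidx S) Y (fun i => pull (theta i) (cls S i))
    (fun i => arr S i \oc theta i).

Definition comp_sink (X : C) (S : sink X) (T : forall i : sidx S, sink (src S i)) :=
  @Sink X {i : sidx S & sidx (T i)} (fun k => src (T (projT1 k)) (projT2 k))
    (fun k => cls (T (projT1 k)) (projT2 k))
    (fun k => arr S (projT1 k) \oc arr (T (projT1 k)) (projT2 k)).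

Definition meet_sink (X : C) (S : sink X) (B : F X) :=
  @Sink X (sidx S) (src S) (fun i => (cls S i `&` pull (arr S i) B)%O)
    (arr S).

(* The pullback of the sink S along a morphism to X, the pullbacks of the     *)
(* arrows of S being given by p (over the sources of S) and q (over Y).       *)
Definition pull_sink (X Y : C) (S : sink X) (P : sidx S -> C)
    (p : forall i, hom (P i) (src S i)) (q : forall i, hom (P i) Y) : sink Y :=
  @Sink Y (sidx S) P (fun i => pull (p i) (cls S i)) q.

End Sinks.

Arguments src {C F X} s i.
Arguments cls {C F X} s i.
Arguments arr {C F X} s i.

Record dform (C : category) := DForm {
  dform_form :> form C;
  adm : forall X : C, sink dform_form X -> dform_form X -> Prop;
  adm_final : forall X (S : sink dform_form X) U, adm S U -> is_final S U;
  adm_iso : forall X (S : sink dform_form X) U (Y : sidx S -> C)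
    (theta : forall i, hom (Y i) (src S i)),
    (forall i, is_iso (theta i)) -> adm S U -> adm (change_sources theta) U;
  adm_unit : forall X (A : dform_form X), adm (unit_sink A) A;
  adm_reindex : forall X (S : sink dform_form X) U (J : small)
    (s : J -> sidx S), bijective s -> adm S U -> adm (reindex_sink s) U;
  adm_comp : forall X (S : sink dform_form X) U
    (T : forall i : sidx S, sink dform_form (src S i)),
    adm S U -> (forall i, adm (T i) (cls S i)) -> adm (comp_sink T) U;
  adm_meet : forall X (S : sink dform_form X) U (B : dform_form X),
    adm S U -> adm (meet_sink S B) (U `&` B)%O }.

Definition strong (C : category) (F : dform C) :=
  forall (X Y : C) (h : hom Y X) (S : sink F X) (U : F X), adm S U ->
  forall (P : sidx S -> C) (p : forall i, hom (P i) (src S i))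
    (q : forall i, hom (P i) Y),
    (forall i, is_pullback (arr S i) h (p i) (q i)) ->
    adm (pull_sink p q) (pull h U).

Section Minimal.
Variables (C : category) (F : form C).

(* The presentations obtained from A = \nabla(A, 1_X) by bijective            *)
(* reindexing and isomorphic change of sources.                               *)
Definition minimal_adm (X : C) (S : sink F X) (U : F X) :=
  [/\ exists i0 : sidx S, forall i, i = i0,
      forall i, is_iso (arr S i) &
      forall i, cls S i = pull (arr S i) U].

Lemma is_iso_id (X : C) : is_iso (idc X).
Proof. by exists (idc X); rewrite comp_idl. Qed.

Lemma is_iso_comp (X Y Z : C) (g : hom Y Z) (f : hom X Y) :
  is_iso g -> is_iso f -> is_iso (g \oc f).
Proof.
move=> [g' [g'g gg']] [f' [f'f ff']]; exists (f' \oc g'); split.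
  by rewrite -compA (compA g') g'g comp_idl.
by rewrite -compA (compA f) ff' comp_idl.
Qed.

Lemma le_pull (X Y : C) (f : hom X Y) (A B : F Y) :
  (A <= B)%O -> (pull f A <= pull f B)%O.
Proof. by move=> /meet_idPl AB; rewrite -AB pull_meet leIr. Qed.

Lemma minimal_adm_final X (S : sink F X) U : minimal_adm S U -> is_final S U.
Proof.
move=> [[i _] iso_S clsE]; split=> [j|V le_SV]; first by rewrite clsE.
have [g [_ fg]] := iso_S i.
have := le_pull g (le_SV i).
by rewrite clsE -!pull_comp fg !pull_id.
Qed.

Lemma minimal_adm_iso X (S : sink F X) U (Y : sidx S -> C)
    (theta : forall i, hom (Y i) (src S i)) :
  (forall i, is_iso (theta i)) -> minimal_adm S U ->
  minimal_adm (change_sources theta) U.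
Proof.
move=> iso_theta [S1 iso_S clsE]; split=> //= i.
  exact: is_iso_comp.
by rewrite clsE pull_comp.
Qed.

Lemma minimal_adm_unit X (A : F X) : minimal_adm (unit_sink A) A.
Proof.
split=> [|_|_] /=; first by exists tt => -[].
  exact: is_iso_id.
by rewrite pull_id.
Qed.

Lemma minimal_adm_reindex X (S : sink F X) U (J : small) (s : J -> sidx S) :
  bijective s -> minimal_adm S U -> minimal_adm (reindex_sink s) U.
Proof.
move=> [t sK tK] [[i0 S1] iso_S clsE]; split=> //=; exists (t i0) => j.
by rewrite -[j]sK (S1 (s j)).
Qed.

Lemma minimal_adm_comp X (S : sink F X) U
    (T : forall i : sidx S, sink F (src S i)) :
  minimal_adm S U -> (forall i, minimal_adm (T i) (cls S i)) ->
  minimal_adm (comp_sink T) U.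
Proof.
move=> [[i0 S1] iso_S clsE] admT; split=> /=.
- have [[j0 T1] _ _] := admT i0.
  by exists (existT _ i0 j0) => -[i j]; move: j; rewrite (S1 i) => j; rewrite (T1 j).
- by move=> [i j]; have [_ iso_T _] := admT i; exact: is_iso_comp.
- by move=> [i j]; have [_ _ clsT] := admT i; rewrite /= clsT clsE pull_comp.
Qed.

Lemma minimal_adm_meet X (S : sink F X) U (B : F X) :
  minimal_adm S U -> minimal_adm (meet_sink S B) (U `&` B)%O.
Proof. by move=> [S1 iso_S clsE]; split=> //= i; rewrite clsE pull_meet. Qed.

Definition minimal : dform C :=
  DForm minimal_adm_final minimal_adm_iso minimal_adm_unit minimal_adm_reindex
    minimal_adm_comp minimal_adm_meet.

Lemma minimal_strong : strong minimal.
Proof.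
move=> X Y h S U [S1 iso_S clsE] P p q pb; split=> //= i; last first.
  by rewrite clsE -!pull_comp (pb i).1.
have [g [gf fg]] := iso_S i; have [sq univ] := pb i.
have [|r [[pr qr] _]] := univ Y (g \oc h) (idc Y).
  by rewrite compA fg comp_idl comp_idr.
exists r; split=> //.
have [c [_ c_uniq]] := univ (P i) (p i) (q i) sq.
rewrite -(c_uniq (idc (P i))) ?comp_idr //; symmetry; apply: c_uniq.
by rewrite !compA pr qr comp_idl -compA -sq compA gf comp_idl.
Qed.

End Minimal.

Definition map_sink (C : category) (F G : form C) (u : forall X, F X -> G X)
    (X : C) (S : sink F X) : sink G X :=
  @Sink C G X (sidx S) (src S) (fun i => u _ (cls S i)) (arr S).

Record dmorph (C : category) (F G : dform C) := DMorph {
  dapp :> forall X, F X -> G X;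
  dapp_nat : forall X Y (f : hom X Y) (A : F Y),
    dapp (pull f A) = pull f (dapp A);
  dapp_top : forall X, @dapp X \top%O = \top%O;
  dapp_meet : forall X, {morph @dapp X : A B / (A `&` B)%O};
  dapp_adm : forall X (S : sink F X) (U : F X),
    adm S U -> adm (map_sink dapp S) (dapp U) }.

Section DFrm.
Variable C : category.

Lemma dmorph_eq (F G : dform C) (u v : dmorph F G) :
  dapp u = dapp v -> u = v.
Proof.
case: u v => [u nu tu mu au] [v nv tv mv av] /= uv.
by subst v; congr DMorph; exact: Prop_irrelevance.
Qed.

Definition did (F : dform C) : dmorph F F.
Proof.
by apply: (@DMorph _ F F (fun X A => A)) => // X [].
Defined.

Definition dcomp (F G H : dform C) (v : dmorph G H) (u : dmorph F G) :
  dmorph F H.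
Proof.
apply: (@DMorph _ F H (fun X A => v X (u X A))).
- by move=> X Y f A; rewrite !dapp_nat.
- by move=> X; rewrite !dapp_top.
- by move=> X A B; rewrite !dapp_meet.
- by move=> X S U /(dapp_adm u)/(dapp_adm v).
Defined.

Lemma dcomp_idl (F G : dform C) (u : dmorph F G) : dcomp (did G) u = u.
Proof. exact: dmorph_eq. Qed.

Lemma dcomp_idr (F G : dform C) (u : dmorph F G) : dcomp u (did F) = u.
Proof. exact: dmorph_eq. Qed.

Lemma dcompA (F G H K : dform C) (w : dmorph H K) (v : dmorph G H)
  (u : dmorph F G) : dcomp w (dcomp v u) = dcomp (dcomp w v) u.
Proof. exact: dmorph_eq. Qed.

Definition dform_category : category := Category dcomp_idl dcomp_idr dcompA.

Definition dnull (F G : dform C) (n : dmorph F G) :=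
  forall X (A : F X), n X A = \top%O.

End DFrm.

Definition full_subcategory (D : category) (P : D -> Prop) : category :=
  @Category {X : D | P X} (fun X Y => hom (sval X) (sval Y))
    (fun X => idc (sval X)) (fun X Y Z g f => g \oc f)
    (fun X Y f => comp_idl f) (fun X Y f => comp_idr f)
    (fun X Y Z W h g f => compA h g f).

(* A category with a distinguished class of null morphisms, relative to which *)
(* kernels and cokernels are taken.                                           *)
Record ncategory := NCategory {
  ncat :> category;
  null : forall X Y : ncat, hom X Y -> Prop }.

Definition DFrm (C : category) : ncategory :=
  @NCategory (dform_category C) (@dnull C).

Definition SDFrm (C : category) : ncategory :=
  @NCategory (full_subcategory (@strong C : DFrm C -> Prop))
    (fun F G n => dnull n).

Section Extensions.
Variable D : ncategory.

Definition is_kernel (K F G : D) (k : hom K F) (u : hom F G) :=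
  null (u \oc k) /\
  forall (H : D) (h : hom H F), null (u \oc h) ->
    exists! h' : hom H K, k \oc h' = h.

Definition is_cokernel (F G Q : D) (q : hom G Q) (u : hom F G) :=
  null (q \oc u) /\
  forall (H : D) (h : hom G H), null (h \oc u) ->
    exists! h' : hom Q H, h' \oc q = h.

Definition short_exact (K F Q : D) (k : hom K F) (q : hom F Q) :=
  is_kernel k q /\ is_cokernel q k.

Variable F : D.

Record ses := Ses {
  ses_ker : D;
  ses_quo : D;
  ses_inj : hom ses_ker F;
  ses_proj : hom F ses_quo;
  ses_exact : short_exact ses_inj ses_proj }.

Definition ses_iso (s t : ses) : Prop :=
  exists (a : hom (ses_ker s) (ses_ker t)) (b : hom (ses_quo s) (ses_quo t)),
    [/\ is_iso a, is_iso b, ses_inj t \oc a = ses_inj s &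
        b \oc ses_proj s = ses_proj t].

Definition extensional_presentation :=
  {E : ses -> Prop | exists s, E = ses_iso s}.

End Extensions.

Section KernelFibre.
Variables (C : category) (F : DFrm C).

(* The condition q_X(A) = \top does not depend on the short exact sequence    *)
(* chosen in the isomorphism class E.                                         *)
Definition kernel_fibre (E : extensional_presentation F) (X : C) :
    set (fiber F X) :=
  [set A | exists2 s : ses F, sval E s & ses_proj s X A = \top%O].

Arguments kernel_fibre E X _ : clear implicits.

(* Only meaningful when the fibre over X has a least cluster, namely bot. *)
Definition presentation_Hausdorff (E : extensional_presentation F) (X : C) :=
  exists bot : fiber F X,
    (forall A, (bot <= A)%O) /\ infimums (kernel_fibre E X) bot.

End KernelFibre.

Arguments kernel_fibre {C F} E X _.

Section Groups.

Lemma mult_eq (G H : groupType) (f g : {multiplicative G -> H}) :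
  (f : G -> H) = g -> f = g.
Proof.
case: f g => f [[fM]] [g [[gM]]] /= fg; subst g.
by rewrite (Prop_irrelevance fM gM).
Qed.

Lemma mult1 (G H : groupType) (f : {multiplicative G -> H}) : f 1%g = 1%g.
Proof. by apply: (mulgI (f 1%g)); rewrite -gmulfM !mulg1. Qed.

Lemma multV (G H : groupType) (f : {multiplicative G -> H}) (x : G) :
  f x^-1%g = ((f x)^-1)%g.
Proof. by apply: (mulgI (f x)); rewrite -gmulfM !mulgV mult1. Qed.

Definition grp_id (G : groupType) : {multiplicative G -> G} := @idfun G.

Definition grp_comp (G H K : groupType) (g : {multiplicative H -> K})
  (f : {multiplicative G -> H}) : {multiplicative G -> K} := g \o f.

Definition Grp : category.
Proof.
apply: (@Category groupType (fun G H => {multiplicative G -> H})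
          grp_id grp_comp).
- by move=> G H f; exact: mult_eq.
- by move=> G H f; exact: mult_eq.
- by move=> G H K L h g f; exact: mult_eq.
Defined.

Definition Grp_small : small := groupType.

End Groups.

Record subgroup (G : groupType) := Subgroup {
  subgroup_set :> set G;
  subgroup_closed : group_closed [pred x | x \in subgroup_set] }.

Section SubgroupLattice.
Variable G : groupType.

Lemma subgroup_eq (A B : subgroup G) : (A : set G) = B -> A = B.
Proof.
case: A B => [A cA] [B cB] /= AB; subst B.
by rewrite (Prop_irrelevance cA cB).
Qed.

Lemma subgroup1 (A : subgroup G) : subgroup_set A 1%g.
Proof. by have [/set_mem] := subgroup_closed A. Qed.

Lemma subgroupF (A : subgroup G) x y :
  subgroup_set A x -> subgroup_set A y -> subgroup_set A (x / y)%g.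
Proof.
move=> Ax Ay; have [_ cA] := subgroup_closed A.
by apply: set_mem; apply: cA; apply: mem_set.
Qed.

Lemma group_closed_set (A : set G) :
  A 1%g -> (forall x y, A x -> A y -> A (x / y)%g) ->
  group_closed [pred x | x \in A].
Proof.
move=> A1 AF; split=> [|x y /set_mem Ax /set_mem Ay]; first exact: mem_set.
exact/mem_set/AF.
Qed.

HB.instance Definition _ := gen_eqMixin (subgroup G).
HB.instance Definition _ := gen_choiceMixin (subgroup G).

Definition subgroup_le (A B : subgroup G) : bool := `[< A `<=` B >].

Lemma subgroup_le_refl : reflexive subgroup_le.
Proof. by move=> A; apply/asboolP. Qed.

Lemma subgroup_le_anti : antisymmetric subgroup_le.
Proof.
move=> A B /andP[/asboolP AB /asboolP BA].
by apply: subgroup_eq; apply/seteqP.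
Qed.

Lemma subgroup_le_trans : transitive subgroup_le.
Proof.
move=> B A D /asboolP AB /asboolP BD; apply/asboolP.
exact: subset_trans AB BD.
Qed.

HB.instance Definition _ := Order.Le_isPOrder.Build form_display (subgroup G)
  subgroup_le_refl subgroup_le_anti subgroup_le_trans.

Definition subgroup_top : subgroup G.
Proof. by apply: (@Subgroup G setT); exact: group_closed_set. Defined.

Lemma subgroup_le_top (A : subgroup G) : (A <= subgroup_top)%O.
Proof. exact/asboolP. Qed.

HB.instance Definition _ :=
  Order.hasTop.Build form_display (subgroup G) subgroup_le_top.

Definition subgroup_meet (A B : subgroup G) : subgroup G.
Proof.
apply: (@Subgroup G (A `&` B)); apply: group_closed_set.
  by split; exact: subgroup1.
by move=> x y [Ax Bx] [Ay By]; split; exact: subgroupF.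
Defined.

Lemma subgroup_lexI (A B D : subgroup G) :
  (A <= subgroup_meet B D)%O = (A <= B)%O && (A <= D)%O.
Proof.
apply/asboolP/andP => [ABD|[/asboolP AB /asboolP AD]].
  by split; apply/asboolP => x /ABD[].
by move=> x Ax; split; [exact: AB|exact: AD].
Qed.

HB.instance Definition _ := Order.POrder_isMeetSemilattice.Build form_display
  (subgroup G) subgroup_lexI.

End SubgroupLattice.

Definition subgroup_preim (G H : groupType) (f : {multiplicative G -> H})
  (B : subgroup H) : subgroup G.
Proof.
apply: (@Subgroup G (f @^-1` B)); apply: group_closed_set.
  by rewrite /= mult1; exact: subgroup1.
by move=> x y /= Bx By; rewrite gmulfM multV; exact: subgroupF.
Defined.

Definition subgroup_form : form Grp.
Proof.
apply: (@Form Grp (fun G => subgroup G) subgroup_preim).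
- by move=> G A; exact: subgroup_eq.
- by move=> G H K g f A; exact: subgroup_eq.
- by move=> G H f; exact: subgroup_eq.
- by move=> G H f A B; exact: subgroup_eq.
Defined.

Definition SubGrp : DFrm Grp := minimal subgroup_form.

Definition SSubGrp : SDFrm Grp := exist _ SubGrp (@minimal_strong _ subgroup_form).

Definition lattice_filter (d : Order.disp_t) (L : tMeetSemilatticeType d)
    (N : set L) :=
  [/\ N \top%O,
      forall A B, N A -> N B -> N (A `&` B)%O &
      forall A B, N A -> (A <= B)%O -> N B].

Definition filter_assignment :=
  {N : forall G : groupType, set (subgroup G) |
    (forall G, lattice_filter (N G)) /\
    forall (G H : groupType) (f : {multiplicative G -> H}) (U : subgroup H),
      N H U -> N G (subgroup_preim f U)}.

Record topology_on (T : Type) := TopologyOn {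
  opens : set (set T);
  opensT : opens setT;
  opensI : forall A B, opens A -> opens B -> opens (A `&` B);
  opens_bigcup : forall F : set (set T),
    F `<=` opens -> opens (\bigcup_(A in F) A) }.

(* An alias of G, so that tau is found by unification. *)
Definition tspace (G : groupType) (tau : topology_on G) : Type := G.

Section Space.
Variables (G : groupType) (tau : topology_on G).

HB.instance Definition _ := Group.on (tspace tau).

Lemma opens_bigcup_fam (I : Type) (f : I -> set (tspace tau)) :
  (forall i, opens tau (f i)) -> opens tau (\bigcup_i f i).
Proof.
move=> f_open; have -> : \bigcup_i f i = \bigcup_(A in range f) A.
  by rewrite bigcup_image.
by apply: opens_bigcup => _ [i _ <-].
Qed.

HB.instance Definition _ := isOpenTopological.Build (tspace tau)
  (opensT tau) (@opensI _ tau) opens_bigcup_fam.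

End Space.

Definition group_topology (G : groupType) (tau : topology_on G) :=
  continuous (fun x : tspace tau * tspace tau => (x.1 * x.2)%g : tspace tau) /\
  continuous (fun x : tspace tau => (x^-1)%g : tspace tau).

Definition nonarchimedean (G : groupType) (tau : topology_on G) :=
  group_topology tau /\
  forall V : set (tspace tau), nbhs (1%g : tspace tau) V ->
    exists U : subgroup G, open (U : set (tspace tau)) /\ U `<=` V.

Definition functorial_topology :=
  {tau : forall G : groupType, topology_on G |
    (forall G, nonarchimedean (tau G)) /\
    forall (G H : groupType) (f : {multiplicative G -> H}),
      continuous (f : tspace (tau G) -> tspace (tau H))}.

(* Main.v *)
From HB Require Import structures.
Require Import Defs.
From mathcomp Require Import all_boot all_order.
From mathcomp Require Import all_classical topology.

Set Implicit Arguments.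
Unset Strict Implicit.
Unset Printing Implicit Defensive.

Import Order.TTheory.
Local Open Scope classical_set_scope.
Local Open Scope cat_scope.
Local Open Scope order_scope.

(** In a short exact sequence each of the two maps determines the other up to
isomorphism, so everything hinges on the clusters that the quotient map sends
to the top. They form a filter in each fibre, stable under pullback, and they
are a complete invariant of the sequence: if two sequences have the same such
clusters then each quotient map kills the other kernel, and the universal
properties give the isomorphisms ([ses_iso_of_null], [ses_iso_kernel]).

Conversely, every stable family of filters N occurs. Its kernel term is N
itself, as a subform of F. Its quotient identifies A and B when they agree
after meeting with some member of N, which is realized by sending A to the
filter generated by A and N. Both terms carry the minimal distributivity. This
gives a cokernel in the category of all distributivity forms because a
morphism out of a minimal form is nothing but a natural family of
meet-preserving maps: unit presentations, their reindexings and their changes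
of source are admissible in every target ([minimal_map]). It gives a kernel
because a presentation that is minimal in F and has all its clusters in N is
minimal in N. These two facts are [rfilter_cokernel] and [member_kernel].

Minimal forms are strong, so this same sequence classifies the strong
presentations; comparing with it shows that a sequence exact among strong
forms is exact among all forms ([strong_short_exact]). None of this is special
to groups.

For groups, a non-Archimedean group topology is recovered from its open
subgroups, a set being open when around each of its points it contains a coset
of an open subgroup ([nonarchimedean_opens]). Conversely a filter of subgroups
defines a topology in this way; multiplication is continuous because the
filter is stable under conjugation, which is pullback along an inner
automorphism ([filter_conj]). Finally, both Hausdorff conditions say that the
members of the filter meet in the trivial subgroup. *)

(** * Isomorphism classes and complete invariants *)

Definition iso_classes (A : Type) (R : A -> A -> Prop) :=
  {E : A -> Prop | exists s, E = R s}.

Definition class_rep (A : Type) (R : A -> A -> Prop) (E : iso_classes R) : A :=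
  sval (cid (svalP E)).

Lemma class_repE (A : Type) (R : A -> A -> Prop) (E : iso_classes R) :
  sval E = R (class_rep E).
Proof. exact: svalP (cid (svalP E)). Qed.

Lemma invariant_class_rep (A : Type) (B : Type) (R : A -> A -> Prop)
    (phi : A -> B) (E : iso_classes R) s :
  (forall s t, R s t <-> phi s = phi t) ->
  sval E s <-> phi (class_rep E) = phi s.
Proof. by move=> phiP; rewrite class_repE; apply: phiP. Qed.

(** The points of [iso_classes R] are predicates, so a complete invariant is read
off on an arbitrary representative of the class. *)
Lemma complete_invariant_bij (A B : Type) (R : A -> A -> Prop) (phi : A -> B) :
  (forall s t, R s t <-> phi s = phi t) -> (forall b, exists s, phi s = b) ->
  bijective (fun E : iso_classes R => phi (class_rep E)).
Proof.
move=> phiP phi_surj.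
have [r rP] := choice phi_surj.
exists (fun b => exist _ (R (r b)) (ex_intro _ (r b) erefl)) => [E|b].
  case: E (class_repE E) => E E_class /= defE; apply: eq_exist.
  rewrite [RHS]defE.
  apply/funext => s; apply/propext.
  by rewrite !phiP rP.
set E := exist _ _ _; rewrite -[RHS]rP.
by apply/(invariant_class_rep E (r b) phiP); apply/phiP.
Qed.

(** * Kernels, cokernels and isomorphisms *)

Section Exactness.
Variable D : ncategory.

(** The maps u and u' need not be related beyond killing each other's kernels,
which is what lets two sequences be compared without an a priori morphism
between their quotients. *)
Lemma is_kernel_uniq (F G G' K K' : D) (k : hom K F) (k' : hom K' F)
    (u : hom F G) (u' : hom F G') :
  is_kernel k u -> is_kernel k' u' -> null (u \oc k') -> null (u' \oc k) ->
  exists2 a : hom K K', is_iso a & k' \oc a = k.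
Proof.
move=> [uk kP] [uk' kP'] /kP[b [kb _]] /kP'[a [ka _]]; exists a => //.
have [c [_ c_uniq]] := kP _ _ uk; have [d [_ d_uniq]] := kP' _ _ uk'.
exists b; split.
  transitivity c; [symmetry|]; apply: c_uniq; rewrite ?comp_idr //.
  by rewrite Defs.compA kb.
transitivity d; [symmetry|]; apply: d_uniq; rewrite ?comp_idr //.
by rewrite Defs.compA ka.
Qed.

Lemma is_cokernel_uniq (F G G' Q Q' : D) (q : hom F Q) (q' : hom F Q')
    (u : hom G F) (u' : hom G' F) :
  is_cokernel q u -> is_cokernel q' u' -> null (q' \oc u) -> null (q \oc u') ->
  exists2 b : hom Q Q', is_iso b & b \oc q = q'.
Proof.
move=> [qu qP] [qu' qP'] /qP[b [bq _]] /qP'[a [aq _]]; exists b => //.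
have [c [_ c_uniq]] := qP _ _ qu; have [d [_ d_uniq]] := qP' _ _ qu'.
exists a; split.
  transitivity c; [symmetry|]; apply: c_uniq; rewrite ?comp_idl //.
  by rewrite -Defs.compA bq.
transitivity d; [symmetry|]; apply: d_uniq; rewrite ?comp_idl //.
by rewrite -Defs.compA aq.
Qed.

(** The two hypotheses are all that links the sequences: each kernel factors
through the other, and dually for the cokernels. *)
Lemma ses_iso_of_null (F : D) (s t : ses F) :
  null (ses_proj s \oc ses_inj t) -> null (ses_proj t \oc ses_inj s) ->
  ses_iso s t.
Proof.
move=> st ts; have [[ks qs] [kt qt]] := (ses_exact s, ses_exact t).
have [a iso_a ka] := is_kernel_uniq ks kt st ts.
have [b iso_b bq] := is_cokernel_uniq qs qt ts st.
by exists a, b.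
Qed.

Definition null_ideal := forall (X Y Z : D) (g : hom Y Z) (f : hom X Y),
  null g \/ null f -> null (g \oc f).

Hypothesis null_id : null_ideal.

Lemma is_kernel_iso (F G G' K K' : D) (k : hom K F) (k' : hom K' F)
    (u : hom F G) (a : hom K K') (b : hom G G') :
  is_kernel k u -> is_iso a -> is_iso b -> k' \oc a = k ->
  is_kernel k' (b \oc u).
Proof.
move=> [uk kP] [a' [a'a aa']] [b' [b'b bb']] ka.
have ka' : k' = k \oc a' by rewrite -ka -Defs.compA aa' comp_idr.
split=> [|H h buh].
  rewrite ka' -Defs.compA; apply: null_id; right.
  by rewrite Defs.compA; apply: null_id; left.
have /kP[x [kx x_uniq]] : null (u \oc h).
  rewrite -[u]comp_idl -b'b -!Defs.compA; apply: null_id; right.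
  by rewrite Defs.compA.
exists (a \oc x); split=> [|y ky]; first by rewrite Defs.compA ka.
by rewrite (x_uniq (a' \oc y)) ?Defs.compA ?aa' ?comp_idl // -ka'.
Qed.

Lemma is_cokernel_iso (F G G' Q Q' : D) (q : hom F Q)
    (u : hom G F) (u' : hom G' F) (a : hom G G') (b : hom Q Q') :
  is_cokernel q u -> is_iso a -> is_iso b -> u' \oc a = u ->
  is_cokernel (b \oc q) u'.
Proof.
move=> [qu qP] [a' [a'a aa']] [b' [b'b bb']] ua.
have ua' : u' = u \oc a' by rewrite -ua -Defs.compA aa' comp_idr.
split=> [|H h hu].
  rewrite ua' -Defs.compA; apply: null_id; right.
  by rewrite Defs.compA; apply: null_id; left.
have /qP[x [xq x_uniq]] : null (h \oc u).
  by rewrite -ua Defs.compA; apply: null_id; left.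
exists (x \oc b'); split=> [|y yq].
  by rewrite Defs.compA -(Defs.compA x) b'b comp_idr.
by rewrite (x_uniq (y \oc b)) -?Defs.compA ?bb' ?comp_idr.
Qed.

Lemma short_exact_iso (F K K' Q Q' : D) (k : hom K F) (k' : hom K' F)
    (q : hom F Q) (q' : hom F Q') (a : hom K K') (b : hom Q Q') :
  short_exact k q -> is_iso a -> is_iso b -> k' \oc a = k -> b \oc q = q' ->
  short_exact k' q'.
Proof.
move=> [kq qk] iso_a iso_b ka <-; split.
  exact: is_kernel_iso kq iso_a iso_b ka.
exact: is_cokernel_iso qk iso_a iso_b ka.
Qed.

End Exactness.

Lemma dnull_ideal (C : category) : null_ideal (DFrm C).
Proof.
move=> F G H g f [g_null|f_null] X A /=; first exact: g_null.
by rewrite f_null dapp_top.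
Qed.

(** * Morphisms out of minimal distributivity forms *)

Section MinimalDomain.
Variables (C : category) (F : form C) (G : dform C).
Variable u : forall X, F X -> G X.
Hypothesis u_nat : forall X Y (f : hom X Y) (A : F Y),
  u (pull f A) = pull f (u A).
Hypothesis u_top : forall X, u (\top : F X) = \top.
Hypothesis u_meet : forall X, {morph @u X : A B / A `&` B}.

(** A minimal presentation is a unit presentation up to reindexing by a singleton
and an invertible change of source, and the axioms make these admissible in any
distributivity form. *)
Lemma minimal_map_adm X (S : sink F X) (U : F X) :
  minimal_adm S U -> adm (map_sink u S) (u U).
Proof.
case: S => I src cls arr [/= [i0 I1] iso_S clsE].
(* The arrows of the sink themselves are the change of source. *)
pose T := @change_sources C G X
  (reindex_sink (S := unit_sink (u U)) (fun _ : I => tt)) src arr.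
have -> : map_sink u (Sink cls arr) = T.
  rewrite /map_sink /T /change_sources /reindex_sink /=; congr Sink.
    by apply: functional_extensionality_dep => i; rewrite clsE u_nat.
  by apply: functional_extensionality_dep => i; rewrite comp_idl.
apply: adm_iso => //; apply: adm_reindex; last exact: adm_unit.
by exists (fun=> i0) => [i|[]].
Qed.

Definition minimal_map : dmorph (minimal F) G :=
  DMorph (F := minimal F) u_nat u_top u_meet minimal_map_adm.

End MinimalDomain.

(** * The short exact sequence of a family of filters *)

Definition pull_filter (C : category) (F : form C) :=
  {N : forall X : C, set (F X) |
    (forall X, lattice_filter (N X)) /\
    forall (X Y : C) (f : hom X Y) (U : F Y), N Y U -> N X (pull f U)}.

Section FilterSequence.
Variables (C : category) (F : form C) (N : pull_filter F).
Implicit Types X Y : C.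

Lemma filter_top X : sval N X \top.
Proof. by have [/(_ X)[]] := svalP N. Qed.

Lemma filterI X A B : sval N X A -> sval N X B -> sval N X (A `&` B).
Proof. by have [/(_ X)[_ NI _] _] := svalP N; exact: NI. Qed.

Lemma filter_le X A B : sval N X A -> A <= B -> sval N X B.
Proof. by have [/(_ X)[_ _ Nle] _] := svalP N; exact: Nle. Qed.

Lemma filter_pull X Y (f : hom X Y) A : sval N Y A -> sval N X (pull f A).
Proof. by have [_] := svalP N; exact. Qed.

Record member X := Member { mem_val : F X; mem_valP : sval N X mem_val }.

Lemma mem_val_inj X : injective (@mem_val X).
Proof.
move=> [A NA] [B NB] /= AB; subst B.
by rewrite (Prop_irrelevance NA NB).
Qed.

HB.instance Definition _ X := gen_eqMixin (member X).
HB.instance Definition _ X := gen_choiceMixin (member X).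

Definition member_le X (a b : member X) := mem_val a <= mem_val b.

Lemma member_le_refl X : reflexive (@member_le X).
Proof. by move=> a; exact: lexx. Qed.

Lemma member_le_anti X : antisymmetric (@member_le X).
Proof. by move=> a b /le_anti/mem_val_inj. Qed.

Lemma member_le_trans X : transitive (@member_le X).
Proof. by move=> b a c; exact: le_trans. Qed.

HB.instance Definition _ X := Order.Le_isPOrder.Build form_display (member X)
  (@member_le_refl X) (@member_le_anti X) (@member_le_trans X).

Definition member_top X : member X := Member (@filter_top X).

Lemma member_lex1 X (a : member X) : a <= member_top X.
Proof. exact: lex1. Qed.

HB.instance Definition _ X :=
  Order.hasTop.Build form_display (member X) (@member_lex1 X).

Definition member_meet X (a b : member X) : member X :=
  Member (filterI (mem_valP a) (mem_valP b)).

Lemma member_lexI X (a b c : member X) :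
  (a <= member_meet b c) = (a <= b) && (a <= c).
Proof. exact: lexI. Qed.

HB.instance Definition _ X := Order.POrder_isMeetSemilattice.Build form_display
  (member X) (@member_lexI X).

Definition member_pull X Y (f : hom X Y) (a : member Y) : member X :=
  Member (filter_pull f (mem_valP a)).

Definition member_form : form C.
Proof.
apply: (@Form C (fun X => member X) member_pull).
- by move=> X a; apply: mem_val_inj; exact: pull_id.
- by move=> X Y Z g f a; apply: mem_val_inj; exact: pull_comp.
- by move=> X Y f; apply: mem_val_inj; exact: pull_top.
- by move=> X Y f a b; apply: mem_val_inj; exact: pull_meet.
Defined.

Definition member_incl : dmorph (minimal member_form) (minimal F).
Proof.
by apply: (@minimal_map C member_form (minimal F) (fun X a => mem_val a)).
Defined.

Definition filter_above X (A : F X) : set (F X) :=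
  [set B | exists2 U, sval N X U & A `&` U <= B].

(** The fibre of the quotient term: clusters up to agreement after meeting with a
member of N. A class is encoded as the filter generated by N and any of its
representatives, so that equality of classes is equality of sets and the order
is reverse inclusion. *)
Record rfilter X := RFilter {
  rfilter_set : set (F X);
  rfilter_gen : exists A, rfilter_set = filter_above A }.

Definition rfilter_of X (A : F X) : rfilter X :=
  RFilter (ex_intro _ A (erefl (filter_above A))).

Lemma rfilter_set_inj X : injective (@rfilter_set X).
Proof.
move=> [P gP] [Q gQ] /= PQ; subst Q.
by rewrite (Prop_irrelevance gP gQ).
Qed.

Lemma rfilter_ind X (P : rfilter X -> Prop) :
  (forall A, P (rfilter_of A)) -> forall c, P c.
Proof.
move=> P_of c; have [A cA] := rfilter_gen c.
by have -> : c = rfilter_of A by exact: rfilter_set_inj.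
Qed.

HB.instance Definition _ X := gen_eqMixin (rfilter X).
HB.instance Definition _ X := gen_choiceMixin (rfilter X).

Definition rfilter_le X (c d : rfilter X) : bool :=
  `[< (rfilter_set d `<=` rfilter_set c)%classic >].

Lemma rfilter_le_refl X : reflexive (@rfilter_le X).
Proof. by move=> c; apply/asboolP. Qed.

Lemma rfilter_le_anti X : antisymmetric (@rfilter_le X).
Proof.
move=> c d /andP[/asboolP dc /asboolP cd].
by apply: rfilter_set_inj; apply/seteqP.
Qed.

Lemma rfilter_le_trans X : transitive (@rfilter_le X).
Proof.
move=> b c d /asboolP bc /asboolP db; apply/asboolP.
exact: subset_trans db bc.
Qed.

HB.instance Definition _ X := Order.Le_isPOrder.Build form_display (rfilter X)
  (@rfilter_le_refl X) (@rfilter_le_anti X) (@rfilter_le_trans X).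

Lemma rfilter_of_le X (A B : F X) :
  rfilter_of A <= rfilter_of B <-> exists2 U, sval N X U & A `&` U <= B.
Proof.
split=> [/asboolP BA|[U NU AUB]].
  by apply: BA; exists \top; [exact: filter_top|exact: leIl].
apply/asboolP => D [V NV BVD]; exists (U `&` V); first exact: filterI.
by rewrite meetA; apply: le_trans BVD; rewrite leI2.
Qed.

Lemma rfilter_lex1 X (c : rfilter X) : c <= rfilter_of \top.
Proof.
elim/rfilter_ind: c => A; apply/rfilter_of_le.
by exists \top; [exact: filter_top|exact: lex1].
Qed.

HB.instance Definition _ X :=
  Order.hasTop.Build form_display (rfilter X) (@rfilter_lex1 X).

(** The quotient map kills exactly N, so the sequence realizes N. *)
Lemma rfilter_of_top X (A : F X) : rfilter_of A = \top <-> sval N X A.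
Proof.
split=> [A_top|NA].
  have /rfilter_of_le[U NU] : rfilter_of \top <= rfilter_of A.
    by rewrite A_top lex1.
  by rewrite meet1x; exact: filter_le.
apply/eqP; rewrite -le1x; apply/rfilter_of_le; exists A => //.
exact: leIr.
Qed.

Definition rfilter_rep X (c : rfilter X) : F X := sval (cid (rfilter_gen c)).

Lemma rfilter_repK X : cancel (@rfilter_rep X) (@rfilter_of X).
Proof.
by move=> c; apply: rfilter_set_inj; rewrite /= -(svalP (cid (rfilter_gen c))).
Qed.

Definition rfilter_meet X (c d : rfilter X) : rfilter X :=
  rfilter_of (rfilter_rep c `&` rfilter_rep d).

Lemma rfilter_lexI X (c d e : rfilter X) :
  (c <= rfilter_meet d e) = (c <= d) && (c <= e).
Proof.
rewrite -{2}[d]rfilter_repK -{2}[e]rfilter_repK /rfilter_meet.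
elim/rfilter_ind: c => A; move: (rfilter_rep d) (rfilter_rep e) => B D.
apply/idP/andP => [/rfilter_of_le[U NU]|[]].
  by rewrite lexI => /andP[AB AD]; split; apply/rfilter_of_le; exists U.
move=> /rfilter_of_le[U NU AB] /rfilter_of_le[V NV AD].
apply/rfilter_of_le; exists (U `&` V); first exact: filterI.
rewrite lexI (le_trans _ AB) ?(le_trans _ AD) //.
  by rewrite leI2 // leIr.
by rewrite leI2 // leIl.
Qed.

HB.instance Definition _ X := Order.POrder_isMeetSemilattice.Build form_display
  (rfilter X) (@rfilter_lexI X).

Section Lift.
Variables (G : form C) (u : forall X, F X -> G X).
Hypothesis u_meet : forall X, {morph @u X : A B / A `&` B}.
Hypothesis u_null : forall X A, sval N X A -> u A = \top.

Definition rfilter_lift X (c : rfilter X) : G X := u (rfilter_rep c).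

Lemma rfilter_lift_le X (A B : F X) :
  rfilter_of A <= rfilter_of B -> u A <= u B.
Proof.
move=> /rfilter_of_le[U NU /meet_idPl AUB].
(* Meeting with U changes nothing after u, which sends U to the top. *)
by rewrite -[u A]meetx1 -(u_null NU) -u_meet -AUB u_meet leIr.
Qed.

Lemma rfilter_liftE X (A : F X) : rfilter_lift (rfilter_of A) = u A.
Proof.
by apply: le_anti; rewrite !rfilter_lift_le // rfilter_repK.
Qed.

End Lift.

Lemma rfilter_ofI X : {morph @rfilter_of X : A B / A `&` B}.
Proof.
move=> A B; apply: le_anti; apply/andP; split.
  rewrite lexI; apply/andP; split; apply/rfilter_of_le; exists \top;
    rewrite ?meetx1 ?leIl ?leIr //; exact: filter_top.
have := leIr (rfilter_of B) (rfilter_of A).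
have := leIl (rfilter_of A) (rfilter_of B).
elim/rfilter_ind: (_ `&` _) => D.
move=> /rfilter_of_le[U NU DA] /rfilter_of_le[V NV DB].
apply/rfilter_of_le; exists (U `&` V); first exact: filterI.
rewrite lexI (le_trans _ DA) ?(le_trans _ DB) //.
  by rewrite leI2 // leIr.
by rewrite leI2 // leIl.
Qed.

Definition rfilter_pull X Y (f : hom X Y) (c : rfilter Y) : rfilter X :=
  rfilter_of (pull f (rfilter_rep c)).

Lemma rfilter_pullE X Y (f : hom X Y) (A : F Y) :
  rfilter_pull f (rfilter_of A) = rfilter_of (pull f A).
Proof.
have le_pull_of A' B' : rfilter_of A' <= rfilter_of B' ->
    rfilter_of (pull f A') <= rfilter_of (pull f B').
  move=> /rfilter_of_le[U NU AUB]; apply/rfilter_of_le.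
  exists (pull f U); first exact: filter_pull.
  by rewrite -pull_meet le_pull.
by apply: le_anti; rewrite !le_pull_of // rfilter_repK.
Qed.

Definition rfilter_form : form C.
Proof.
apply: (@Form C (fun X => rfilter X) rfilter_pull).
- by move=> X; elim/rfilter_ind => A; rewrite rfilter_pullE pull_id.
- by move=> X Y Z g f; elim/rfilter_ind => A; rewrite !rfilter_pullE pull_comp.
- by move=> X Y f; rewrite rfilter_pullE pull_top.
- move=> X Y f; elim/rfilter_ind => A; elim/rfilter_ind => B.
  by rewrite -rfilter_ofI !rfilter_pullE pull_meet rfilter_ofI.
Defined.

Definition rfilter_proj : dmorph (minimal F) (minimal rfilter_form).
Proof.
apply: (@minimal_map C F (minimal rfilter_form) (fun X A => rfilter_of A)).
- by move=> X Y f A; rewrite /= rfilter_pullE.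
- by [].
- exact: rfilter_ofI.
Defined.

(** A map h into F killed by the quotient takes values in N. Its corestriction
preserves admissibility because h does, and the minimality conditions on a sink
of members can be checked on the underlying clusters. *)
Lemma member_kernel : @is_kernel (DFrm C) _ _ _ member_incl rfilter_proj.
Proof.
split=> [X [A NA]|H h qh]; first exact/rfilter_of_top.
have Nh X A : sval N X (h X A) by apply/rfilter_of_top; exact: qh.
have h'_adm X (S : sink H X) U :
    adm S U -> @minimal_adm C member_form X
      (map_sink (G := member_form) (fun X A => Member (Nh X A)) S)
      (Member (Nh X U)).
  move=> /(dapp_adm h)[S1 iso_S clsE]; split=> // i.
  by apply: mem_val_inj; exact: clsE.
unshelve eexists; first unshelve eapply (@DMorph C H (minimal member_form)
    (fun X A => Member (Nh X A))).
- by move=> X Y f A; apply: mem_val_inj; exact: (dapp_nat h).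
- by move=> X; apply: mem_val_inj; exact: (dapp_top h).
- by move=> X A B; apply: mem_val_inj; exact: (dapp_meet h).
- exact: h'_adm.
split=> [|g gh]; first exact: dmorph_eq.
apply: dmorph_eq; apply/functional_extensionality_dep => X.
by apply/funext => A; apply: mem_val_inj; rewrite /= -gh.
Qed.

(** The induced map has nothing to preserve beyond meets and pullbacks, since the
quotient carries the minimal distributivity. *)
Lemma rfilter_cokernel : @is_cokernel (DFrm C) _ _ _ rfilter_proj member_incl.
Proof.
split=> [X [A NA]|H h hk]; first exact/rfilter_of_top.
have h_null X A : sval N X A -> h X A = \top.
  by move=> NA; exact: (hk X (Member NA)).
have hE X A : rfilter_lift h (rfilter_of A) = h X A.
  exact: (rfilter_liftE (dapp_meet h)).
unshelve eexists; first unshelve eapply (@minimal_map C rfilter_form H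
    (rfilter_lift h)).
- move=> X Y f; elim/rfilter_ind => A.
  by rewrite /= rfilter_pullE !hE dapp_nat.
- by move=> X; rewrite hE dapp_top.
- move=> X; elim/rfilter_ind => A; elim/rfilter_ind => B.
  by rewrite -rfilter_ofI !hE dapp_meet.
split=> [|g gh].
  apply: dmorph_eq; apply/functional_extensionality_dep => X.
  by apply/funext => A; exact: hE.
apply: dmorph_eq; apply/functional_extensionality_dep => X.
by apply/funext; elim/rfilter_ind => A; rewrite /= hE -gh.
Qed.

Definition filter_ses : @ses (DFrm C) (minimal F) :=
  Ses (conj member_kernel rfilter_cokernel).

End FilterSequence.

(** * Classification of the extensional presentations *)

Section Classification.
Variables (C : category) (F : form C).

Definition kernel_filter (G : dform C) (q : dmorph (minimal F) G) :
  pull_filter F.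
Proof.
exists (fun X => [set A | q X A = \top]); split=> [X|X Y f U /= qU].
  split=> [|A B /= qA qB|A B /= qA AB]; first exact: dapp_top.
    by rewrite dapp_meet qA qB meetx1.
  by apply/eqP; rewrite -le1x -qA -(meet_idPl AB) dapp_meet leIr.
by rewrite dapp_nat qU pull_top.
Defined.

Lemma pull_filter_eq (N M : pull_filter F) :
  (forall X A, sval N X A <-> sval M X A) -> N = M.
Proof.
case: N M => [N NP] [M MP] /= NM; apply: eq_exist.
by apply/functional_extensionality_dep => X; apply/seteqP; split=> A /NM.
Qed.

Lemma kernel_filter_iso (G H : dform C) (q : dmorph (minimal F) G)
    (r : dmorph (minimal F) H) (b : hom (G : DFrm C) H) :
  is_iso b -> b \oc (q : hom (minimal F : DFrm C) G) = r ->
  kernel_filter q = kernel_filter r.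
Proof.
move=> [b' [b'b _]] bq; apply: pull_filter_eq => X A /=.
have b'r : b' \oc (r : hom (minimal F : DFrm C) H) = q.
  by rewrite -bq Defs.compA b'b comp_idl.
split=> [qA|rA]; first by rewrite -bq /= qA dapp_top.
by rewrite -b'r /= rA dapp_top.
Qed.

Lemma kernel_filter_null (G H : dform C) (q : dmorph (minimal F) G)
    (r : dmorph (minimal F) H) :
  kernel_filter q = kernel_filter r ->
  forall X (A : F X), q X A = \top <-> r X A = \top.
Proof.
move=> eq_ker X A.
by move/(congr1 (fun N => sval N X A)): eq_ker => /= ->.
Qed.

(** Equal kernel filters make each composite of one inclusion with the other
projection null, since every kernel cluster of one sequence is sent to the top
by the projection of the other. *)
Lemma ses_iso_kernel (s t : @ses (DFrm C) (minimal F)) :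
  ses_iso s t <-> kernel_filter (ses_proj s) = kernel_filter (ses_proj t).
Proof.
split=> [[a [b [_ iso_b _ bq]]]|st]; first exact: kernel_filter_iso iso_b bq.
have ker_eq := kernel_filter_null st.
apply: ses_iso_of_null => X A.
  by apply/ker_eq; have [[tk _] _] := ses_exact t; exact: tk.
by apply/ker_eq; have [[sk _] _] := ses_exact s; exact: sk.
Qed.

Lemma kernel_filter_ses (N : pull_filter F) :
  kernel_filter (ses_proj (filter_ses N)) = N.
Proof. by apply: pull_filter_eq => X A; exact: rfilter_of_top. Qed.

Definition minimal_s : SDFrm C := exist _ (minimal F) (@minimal_strong _ F).

(** Morphisms between strong forms, and the null ones among them, are those of the
ambient category, so kernel filters are equally complete in the subcategory. *)
Lemma ses_iso_kernel_strong (s t : ses minimal_s) :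
  ses_iso s t <-> kernel_filter (ses_proj s) = kernel_filter (ses_proj t).
Proof.
split=> [[a [b [_ iso_b _ bq]]]|st].
  by case: iso_b => b' bb'; apply: kernel_filter_iso bq; exists b'.
have ker_eq := kernel_filter_null st.
apply: ses_iso_of_null => X A.
  by apply/ker_eq; have [[tk _] _] := ses_exact t; exact: tk.
by apply/ker_eq; have [[sk _] _] := ses_exact s; exact: sk.
Qed.

(** Universal properties restrict to a full subcategory. *)
Lemma short_exact_full (K G Q : SDFrm C) (k : hom K G) (q : hom G Q) :
  @short_exact (DFrm C) (sval K) (sval G) (sval Q) k q -> short_exact k q.
Proof.
move=> [[qk kP] [_ qP]]; split; split=> // H h h_null.
  exact: (kP (sval H) h).
exact: (qP (sval H) h).
Qed.

Definition filter_ses_strong (N : pull_filter F) : ses minimal_s :=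
  Ses (short_exact_full
    (K := exist _ (minimal (member_form N)) (@minimal_strong _ _))
    (G := minimal_s)
    (Q := exist _ (minimal (rfilter_form N)) (@minimal_strong _ _))
    (ses_exact (filter_ses N))).

(** The converse of [short_exact_full] is not formal, since there are fewer test
objects in the subcategory. It holds because the model sequence with the same
kernel filter is exact in both categories, and exactness is invariant under
isomorphism. *)
Lemma strong_short_exact (s : ses minimal_s) :
  @short_exact (DFrm C) _ _ _ (ses_inj s) (ses_proj s).
Proof.
pose N := kernel_filter (ses_proj s).
have [a [b [[a' aa'] [b' bb'] ka bq]]] : ses_iso (filter_ses_strong N) s.
  by apply/ses_iso_kernel_strong; exact: kernel_filter_ses.
apply: (short_exact_iso (@dnull_ideal C) (ses_exact (filter_ses N)) _ _ ka bq).
  by exists a'.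
by exists b'.
Qed.

Definition presentation_filter
    (E : @extensional_presentation (DFrm C) (minimal F)) :
  pull_filter F := kernel_filter (ses_proj (class_rep E)).

Definition strong_presentation_filter (E : extensional_presentation minimal_s) :
  pull_filter F := kernel_filter (ses_proj (class_rep E)).

Lemma presentation_filter_bij : bijective presentation_filter.
Proof.
apply: (complete_invariant_bij ses_iso_kernel) => N.
by exists (filter_ses N); exact: kernel_filter_ses.
Qed.

Lemma strong_presentation_filter_bij : bijective strong_presentation_filter.
Proof.
apply: (complete_invariant_bij ses_iso_kernel_strong) => N.
by exists (filter_ses_strong N); exact: kernel_filter_ses.
Qed.

Lemma presentation_filterP
    (E : @extensional_presentation (DFrm C) (minimal F)) s :
  sval E s <-> presentation_filter E = kernel_filter (ses_proj s).
Proof. exact: (invariant_class_rep E s ses_iso_kernel). Qed.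

Lemma strong_presentation_filterP (E : extensional_presentation minimal_s) s :
  sval E s <-> strong_presentation_filter E = kernel_filter (ses_proj s).
Proof. exact: (invariant_class_rep E s ses_iso_kernel_strong). Qed.

Lemma presentation_filterE
    (E : @extensional_presentation (DFrm C) (minimal F)) X :
  sval (presentation_filter E) X = kernel_fibre E X.
Proof.
apply/seteqP; split=> A /=.
  by exists (class_rep E) => //; apply/presentation_filterP.
by move=> [s /presentation_filterP/kernel_filter_null eq_ker] /eq_ker.
Qed.

End Classification.

(** * Group topologies and their open subgroups *)

Local Open Scope group_scope.

Section Subgroups.
Variables (G : groupType) (U : subgroup G).

Lemma subgroupV x : subgroup_set U x -> subgroup_set U x^-1.
Proof.
by move=> Ux; rewrite -div1g; apply: subgroupF => //; exact: subgroup1.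
Qed.

Lemma subgroupM x y :
  subgroup_set U x -> subgroup_set U y -> subgroup_set U (x * y).
Proof.
move=> Ux Uy; rewrite -[y]invgK.
by apply: subgroupF => //; exact: subgroupV.
Qed.

End Subgroups.

Definition trivial_subgroup (G : groupType) : subgroup G.
Proof.
apply: (@Subgroup G [set 1]); apply: group_closed_set => // x y /= -> ->.
by rewrite divgg.
Defined.

Definition conj_hom (G : groupType) (y : G) : {multiplicative G -> G} :=
  HB.pack (conjg^~ y)
    (isMultiplicative.Build G G (conjg^~ y) (fun x z => conjMg x z y)).

Section GroupTopology.
Variables (G : groupType) (tau : topology_on G).
Implicit Types (x y : tspace tau) (V : set (tspace tau)) (U : subgroup G).

Lemma openP V : open V <-> forall x, V x -> nbhs x V.
Proof. by rewrite openE. Qed.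

Hypothesis tau_group : group_topology tau.

(** Left translations are continuous; stated at the level of neighbourhoods, this
transports the neighbourhoods of the identity to every point. *)
Lemma nbhs_translate x y V : nbhs (x * y) V -> nbhs y [set z | V (x * z)].
Proof.
have [mulC _] := tau_group.
move=> /(mulC (x, y))[[P Q] [/= Px Qy] PQV].
apply: filterS Qy => z Qz; apply: (PQV (x, z)); split=> //=.
exact: nbhs_singleton Px.
Qed.

Lemma nbhs_coset U x : open (U : set (tspace tau)) ->
  nbhs x [set z : tspace tau | subgroup_set U (x^-1 * z)].
Proof.
move=> /openP U_open; apply: nbhs_translate.
by rewrite mulVg; apply: U_open; exact: subgroup1.
Qed.

Lemma open_subgroup_le (U U' : subgroup G) :
  open (U : set (tspace tau)) -> (U <= U')%O -> open (U' : set (tspace tau)).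
Proof.
move=> U_open /asboolP UU'; apply/openP => x U'x.
apply: filterS (nbhs_coset x U_open) => z /= Uz.
by rewrite -[z](mulVKg x); apply: subgroupM => //; exact: UU'.
Qed.

End GroupTopology.

Section Nonarchimedean.
Variables (G : groupType) (tau : topology_on G).
Hypothesis tau_na : nonarchimedean tau.

(** Translating open subgroups gives a base of the whole topology, so a
non-Archimedean topology is determined by its open subgroups. *)
Lemma nonarchimedean_opens (V : set G) :
  opens tau V <-> forall x, V x -> exists2 U : subgroup G, opens tau U &
    forall u, subgroup_set U u -> V (x * u).
Proof.
have [tau_group tau_basis] := tau_na.
split=> [V_open x Vx|V_coset].
  have /tau_basis[U [U_open UV]] :
      nbhs (1 : tspace tau) [set z : tspace tau | V ((x : tspace tau) * z)].
    apply: nbhs_translate => //; rewrite mulg1.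
    exact: (openP (V : set (tspace tau))).1.
  by exists U => // u /UV.
apply/(openP (V : set (tspace tau))) => x /V_coset[U U_open xUV].
apply: filterS (nbhs_coset tau_group x U_open) => z /= /xUV.
by rewrite mulVKg.
Qed.

(** Two points p and q that cannot be separated have, for each open subgroup U,
meeting cosets pU and qU, so the quotient of p and q lies in every U. *)
Lemma nonarchimedean_Hausdorff :
  hausdorff_space (tspace tau) <->
  forall x : G,
    (forall U : subgroup G, opens tau U -> subgroup_set U x) -> x = 1.
Proof.
have [tau_group tau_basis] := tau_na.
split=> [hausd x xU|trivI p q pq].
  apply/esym; apply: (hausd (1 : tspace tau) x) => A B A1 Bx.
  have [U [U_open UA]] := tau_basis _ A1.
  by exists x; split; [exact/UA/xU|exact: nbhs_singleton Bx].
suff pq1 : p^-1 * q = 1 by rewrite -[q](mulVKg p) pq1 mulg1.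
apply: trivI => U U_open.
have [z [/= pz qz]] :=
  pq _ _ (nbhs_coset tau_group p U_open) (nbhs_coset tau_group q U_open).
(* The point z lies in both cosets. *)
have -> : p^-1 * q = (p^-1 * z) / (q^-1 * z) by rewrite !gnorm.
exact: subgroupF.
Qed.

End Nonarchimedean.

Lemma topology_on_eq (T : Type) (s t : topology_on T) :
  opens s = opens t -> s = t.
Proof.
case: s t => [s sT sI sU] [t tT tI tU] /= st; subst t.
by congr TopologyOn; exact: Prop_irrelevance.
Qed.

Section FilterTopology.
Variables (N : filter_assignment) (G : groupType).

Let Nfilter : lattice_filter (sval N G) := (svalP N).1 G.

Definition coset_open (V : set G) := forall x, V x ->
  exists2 U : subgroup G, sval N G U & forall u, subgroup_set U u -> V (x * u).

Definition filter_topology : topology_on G.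
Proof.
apply: (@TopologyOn G coset_open) => [x _|A B Ao Bo x [Ax Bx]|F Fo x [A FA Ax]].
- by have [NT _ _] := Nfilter; exists \top%O.
- have [[U NU UA] [V NV VB]] := (Ao _ Ax, Bo _ Bx).
  have [_ NI _] := Nfilter; exists (U `&` V)%O; first exact: NI.
  by move=> u [Uu Vu]; split; [exact: UA|exact: VB].
- have [U NU UA] := Fo _ FA _ Ax; exists U => // u Uu.
  by exists A => //; exact: UA.
Defined.

Lemma filter_topology_subgroup (U : subgroup G) :
  opens filter_topology U <-> sval N G U.
Proof.
have [_ _ Nle] := Nfilter.
split=> [/(_ _ (subgroup1 U))[V NV VU]|NU x Ux].
  by apply: Nle NV _; apply/asboolP => v /VU; rewrite mul1g.
by exists U => // u Uu; exact: subgroupM.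
Qed.

Lemma nbhs_filter_topology (x : tspace filter_topology)
    (V : set (tspace filter_topology)) :
  nbhs x V <-> exists2 U : subgroup G, sval N G U &
    forall u, subgroup_set U u -> V (x * u).
Proof.
rewrite nbhsE; split=> [[B [B_open Bx] BV]|[U NU xUV]].
  by have [U NU xUB] := B_open _ Bx; exists U => // u /xUB/BV.
have xU_open : coset_open [set z | subgroup_set U (x^-1 * z)].
  by move=> z Uz; exists U => // u Uu; rewrite /= mulgA; exact: subgroupM.
exists [set z | subgroup_set U (x^-1 * z)]; last first.
  by move=> z /= /xUV; rewrite mulVKg.
by split=> //=; rewrite mulVg; exact: subgroup1.
Qed.

(** Functoriality along inner automorphisms is what makes left cosets of members
of N as good as right cosets. *)
Lemma filter_conj (y : G) (U : subgroup G) :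
  sval N G U -> sval N G (subgroup_preim (conj_hom y) U).
Proof. exact: (svalP N).2. Qed.

(** The product of the cosets of the conjugate y U y^-1 at x and of U at y is
contained in xyU. *)
Lemma filter_topology_mul (x y : G) (V : set (tspace filter_topology)) :
  nbhs (x * y : tspace filter_topology) V ->
  nbhs ((x, y) : tspace filter_topology * tspace filter_topology)
    [set z | V (z.1 * z.2)].
Proof.
move=> /nbhs_filter_topology[U NU xyUV].
exists ([set z | subgroup_set U ((x^-1 * z) ^ y)],
        [set z | subgroup_set U (y^-1 * z)]).
  split; apply/nbhs_filter_topology.
    exists (subgroup_preim (conj_hom y) U); first exact: filter_conj.
    by move=> u; rewrite /= mulKg.
  by exists U => // u; rewrite /= mulKg.
move=> [a b] [/= Ua Ub].
have -> : a * b = x * y * ((x^-1 * a) ^ y * (y^-1 * b)).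
  by rewrite conjgE !gnorm.
by apply: xyUV; exact: subgroupM.
Qed.

(** The coset of x^-1 U x at x is Ux, whose inverse is x^-1 U. *)
Lemma filter_topology_inv (x : G) (V : set (tspace filter_topology)) :
  nbhs (x^-1 : tspace filter_topology) V ->
  nbhs (x : tspace filter_topology) [set z | V z^-1].
Proof.
move=> /nbhs_filter_topology[U NU xUV]; apply/nbhs_filter_topology.
exists (subgroup_preim (conj_hom x^-1) U); first exact: filter_conj.
move=> u /= Uu; have -> : (x * u)^-1 = x^-1 * (u ^ x^-1)^-1.
  by rewrite conjgE !gnorm.
by apply: xUV; exact: subgroupV.
Qed.

Lemma filter_topology_nonarchimedean : nonarchimedean filter_topology.
Proof.
split; first split=> [[x y] V|x V].
- exact: filter_topology_mul.
- exact: filter_topology_inv.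
move=> V /nbhs_filter_topology[U NU UV]; exists U; split.
  exact/filter_topology_subgroup.
by move=> u /UV; rewrite mul1g.
Qed.

End FilterTopology.

Lemma filter_topology_continuous (N : filter_assignment) (G H : groupType)
    (f : {multiplicative G -> H}) :
  continuous (f : tspace (filter_topology N G) -> tspace (filter_topology N H)).
Proof.
move=> x V /nbhs_filter_topology[U NU fxUV]; apply/nbhs_filter_topology.
exists (subgroup_preim f U); first exact: (svalP N).2.
by move=> u /fxUV; rewrite -gmulfM.
Qed.

Definition topology_of_filter (N : filter_assignment) : functorial_topology :=
  exist _ (filter_topology N)
    (conj (filter_topology_nonarchimedean N) (@filter_topology_continuous N)).

Definition open_subgroups (tau : functorial_topology) : filter_assignment.
Proof.
exists (fun G => [set U : subgroup G | opens (sval tau G) U]).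
have [tau_na tau_cont] := svalP tau; split=> [G|G H f U U_open].
  split=> [|A B|A B]; [exact: opensT|exact: opensI|].
  exact: (open_subgroup_le (tau_na G).1).
exact: (continuousP _).1 (tau_cont G H f) _ U_open.
Defined.

Lemma open_subgroupsK : cancel open_subgroups topology_of_filter.
Proof.
move=> tau; have [tau_na _] := svalP tau.
case: tau tau_na => tau tau_P /= tau_na; apply: eq_exist.
apply/functional_extensionality_dep => G; apply: topology_on_eq.
by apply/seteqP; split=> V /(nonarchimedean_opens (tau_na G)).
Qed.

Lemma topology_of_filterK : cancel topology_of_filter open_subgroups.
Proof.
move=> N; apply: (@pull_filter_eq _ subgroup_form) => G U.
exact: filter_topology_subgroup.
Qed.

(** * The equivalence *)

(** The trivial subgroup is the only possible least cluster, and the greatest lower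
bound of a family of subgroups is their intersection. *)
Lemma presentation_Hausdorff_meet
    (E : @extensional_presentation (DFrm Grp) SubGrp) (G : groupType) :
  presentation_Hausdorff E G <->
  forall x : G,
    (forall U : subgroup G, kernel_fibre E G U -> subgroup_set U x) -> x = 1.
Proof.
have meet_closed : group_closed
    [pred x | x \in \bigcap_(U in kernel_fibre E G) subgroup_set U].
  apply: group_closed_set => [U _|x y Ux Uy U EU]; first exact: subgroup1.
  by apply: subgroupF; [exact: Ux|exact: Uy].
pose meetE : subgroup G := Subgroup meet_closed.
have meetE_lb : lbound (kernel_fibre E G) meetE.
  by move=> U EU; apply/asboolP => x; exact.
split=> [[bot [bot_le [_ bot_glb]]] x xE|trivE].
  have /asboolP meet_bot : (meetE <= bot)%O by exact: bot_glb.
  have /asboolP bot_triv := bot_le (trivial_subgroup G).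
  by apply: bot_triv; apply: meet_bot => U; exact: xE.
have triv_le (U : subgroup G) : (trivial_subgroup G <= U)%O.
  by apply/asboolP => x ->; exact: subgroup1.
exists (trivial_subgroup G); split=> [|]; first exact: triv_le.
split=> [U _|B B_lb]; first exact: triv_le.
apply/asboolP => x Bx; apply: trivE => U EU.
by have /asboolP := B_lb U EU; exact.
Qed.

Theorem theorem3p7 :
  exists (T : extensional_presentation SubGrp -> functorial_topology)
         (S : extensional_presentation SSubGrp -> extensional_presentation SubGrp)
         (N : functorial_topology -> filter_assignment),
    [/\ bijective T, bijective S & bijective N] /\
    [/\ forall (E : extensional_presentation SSubGrp) (s : ses SSubGrp), sval E s ->
          exists ex : @short_exact (DFrm Grp) _ _ _ (ses_inj s) (ses_proj s),
            sval (S E) (Ses ex),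
        forall (tau : functorial_topology) (G : groupType) (U : subgroup G),
          sval (N tau) G U <-> open (U : set (tspace (sval tau G))),
        forall (E : extensional_presentation SubGrp) (G : groupType),
          sval (N (T E)) G = kernel_fibre E G &
        forall (E : extensional_presentation SubGrp) (G : groupType),
          presentation_Hausdorff E G <->
          hausdorff_space (tspace (sval (T E) G))].
Proof.
have [r presK rK] := @presentation_filter_bij Grp subgroup_form.
pose T (E : @extensional_presentation (DFrm Grp) SubGrp) :=
  topology_of_filter (presentation_filter E).
pose S (E : extensional_presentation SSubGrp) :=
  r (strong_presentation_filter E).
have NTE E G : sval (open_subgroups (T E)) G = kernel_fibre E G.
  rewrite /T topology_of_filterK.
  exact: (@presentation_filterE Grp subgroup_form E G).
exists T, S, open_subgroups; split; split.
- apply: bij_comp (presentation_filter_bij _).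
  exact: Bijective topology_of_filterK open_subgroupsK.
- apply: bij_comp (@strong_presentation_filter_bij Grp subgroup_form).
  exact: Bijective rK presK.
- exact: Bijective open_subgroupsK topology_of_filterK.
- move=> E s /strong_presentation_filterP Es.
  exists (strong_short_exact s); apply/presentation_filterP.
  by rewrite /S rK Es.
- by [].
- exact: NTE.
- move=> E G; rewrite presentation_Hausdorff_meet -NTE.
  by split=> /(nonarchimedean_Hausdorff ((svalP (T E)).1 G)).
Qed.
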